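(* Assume the network is UJSC and the weight matrices satisfy the weight rules, the interior-point condition for $(\mathrm{ADRCP}^k)$ holds, and the stepsizes satisfy $\alpha(t)>0$, $\sum_{t=0}^\infty\alpha(t)=\infty$, $\sum_{t=0}^\infty\alpha^2(t)<\infty$ and $\alpha(t)\le\alpha(l)$ for all $t>l\ge 0$. Then for the DPG iteration $\theta_i(t+1)=P_{\Omega_i}\big[\sum_{j=1}^m a_{ij}(t)\theta_j(t)-\alpha(t)c\big]$, with arbitrary initial points $\theta_i(0)\in\mathbb{R}^{n+m}$, there exists an optimal solution $\theta^*\in\Omega^*$ such that $\lim_{t\to\infty}\theta_i(t)=\theta^*$ for every $i\in\mathcal V$.
   Context: Network: agents $\mathcal V=\{1,\dots,m\}$. For each time slot $t\in\mathbb Z_{\ge 0}$ there is a directed graph $\mathcal G(t)=(\mathcal V,\mathcal E(t))$; $(j,i)\in\mathcal E(t)$ means agent $j$ can send information to agent $i$ at slot $t$, and $N_i^{in}(t)=\{j:(j,i)\in\mathcal E(t)\}$. UJSC (uniform joint strong connectivity): there is an integer $S>0$ such that for every $t\ge 0$ the graph $(\mathcal V,\mathcal E(t)\cup\cdots\cup\mathcal E(t+S-1))$ is strongly connected. Weight rules: $A(t)=[a_{ij}(t)]\in\mathbb R^{m\times m}$ with $a_{ij}(t)>0$ if $j\in N_i^{in}(t)$ and $a_{ij}(t)=0$ otherwise; $\sum_{j}a_{ij}(t)=1$ for all $i,t$ (row stochastic, not necessarily column stochastic); $(i,i)\in\mathcal E(t)$ for all $i,t$; and there is $\gamma\in(0,1)$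 with $a_{ij}(t)\ge\gamma$ whenever $a_{ij}(t)>0$ (in particular $a_{ii}(t)\ge\gamma$). Problem data: $X\subseteq\mathbb R^n$ is nonempty, compact and convex. For each $i\in\mathcal V$: $f_i:\mathbb R^n\to\mathbb R$ is convex; $Y_i\subseteq\mathbb R$ is nonempty, compact, convex; $g_i:\mathbb R^n\times Y_i\to\mathbb R$ is continuous on $X\times Y_i$ and convex in $x$ for each fixed $y$; $Y_i^k\subset Y_i$ is a finite set and $\epsilon_i^k>0$. The problem $(\mathrm{ADRCP}^k)$ is: minimize $\sum_{i=1}^m f_i(x)$ over $x\in X$ subject to $g_i(x,y)\le-\epsilon_i^k$ for all $y\in Y_i^k$ and all $i$. Interior-point condition: the feasible set of $(\mathrm{ADRCP}^k)$ is nonempty and there is $\tilde x$ in it with $g_i(\tilde x,y)<-\epsilon_i^k$ for all $y\in Y_i^k$, $i\in\mathcal V$. Epigraphic reformulation: $\theta=(x,u)\in\Theta=X\times\mathbb R^m$; $\Omega_i=\{(x,u)\in\Theta: f_i(x)-u_i\le 0,\ g_i(x,y)\le-\epsilon_i^k\ \forall y\in Y_i^k\}$; $\Omega=\bigcap_{i=1}^m\Omega_i$; $c=(0_n,\tfrac1m\mathbf 1_m)\in\mathbb R^{n+m}$ and $f_0(\theta)=c^\top\theta=\tfrac1m\sum_i u_i$. $\Omega^*$ is the set of minimizers of $f_0$ over $\Omega$ and $f_0^*$ the optimal value. $P_K$ denotes Euclidean projection onto a closed convex set $K$. *)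

(* Defs.v *)
From HB Require Import structures.
From mathcomp Require Import all_boot all_order all_algebra.
From mathcomp Require Import all_classical all_reals all_analysis.
Set Implicit Arguments. Unset Strict Implicit. Unset Printing Implicit Defensive.
Import Order.TTheory GRing.Theory Num.Theory.
Import numFieldNormedType.Exports.
Local Open Scope classical_set_scope.
Local Open Scope ring_scope.

Definition convex_setv {R : realType} {d : nat} (K : set 'rV[R]_d) :=
  forall x y (l : R), K x -> K y -> 0 <= l <= 1 -> K (l *: x + (1 - l) *: y).

Definition convex_setR {R : realType} (K : set R) :=
  forall x y (l : R), K x -> K y -> 0 <= l <= 1 -> K (l * x + (1 - l) * y).

Definition convex_fun {R : realType} {d : nat} (f : 'rV[R]_d -> R) :=
  forall x y (l : R), 0 <= l <= 1 -> f (l *: x + (1 - l) *: y) <= l * f x + (1 - l) * f y.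

Definition convex_in_x {R : realType} {d : nat} (Y : set R) (g : 'rV[R]_d -> R -> R) :=
  forall y, Y y -> convex_fun (fun x => g x y).

Definition sqdist {R : realType} {d : nat} (x y : 'rV[R]_d) : R :=
  \sum_(k < d) (x ord0 k - y ord0 k) ^+ 2.

Definition is_proj {R : realType} {d : nat} (K : set 'rV[R]_d) (v z : 'rV[R]_d) :=
  K z /\ forall w, K w -> sqdist z v <= sqdist w v.

Definition strongly_connected {m : nat} (e : rel 'I_m) :=
  forall i j : 'I_m, connect e i j.

(* E t j i  <->  (j,i) in E(t), i.e. j can send to i at slot t.
   UJSC: the union of S consecutive graphs is strongly connected. *)
Definition UJSC {m : nat} (E : nat -> rel 'I_m) :=
  exists S : nat, (0 < S)%N /\ forall t : nat,
    strongly_connected [rel j i | [exists s : 'I_S, E (t + s)%N j i]].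

Definition weight_rules {R : realType} {m : nat} (E : nat -> rel 'I_m)
    (A : nat -> 'M[R]_m) :=
  (forall t (i j : 'I_m), (0 < A t i j <-> E t j i) /\ (~ E t j i -> A t i j = 0)) /\
  (forall t (i : 'I_m), \sum_(j < m) A t i j = 1) /\
  (forall t (i : 'I_m), E t i i) /\
  (exists gamma : R, 0 < gamma < 1 /\
     forall t (i j : 'I_m), 0 < A t i j -> gamma <= A t i j).

(* epigraphic variables: theta = (x,u), x in R^n, u in R^m *)
Definition xpart {R : realType} {n m : nat} (th : 'rV[R]_(n + m)) : 'rV[R]_n := lsubmx th.
Definition upart {R : realType} {n m : nat} (th : 'rV[R]_(n + m)) : 'rV[R]_m := rsubmx th.

Definition Omega_i {R : realType} {n m : nat} (X : set 'rV[R]_n)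
    (f : 'I_m -> 'rV[R]_n -> R) (g : 'I_m -> 'rV[R]_n -> R -> R)
    (Yk : 'I_m -> set R) (eps : 'I_m -> R) (i : 'I_m) : set 'rV[R]_(n + m) :=
  [set th | X (xpart th) /\ f i (xpart th) - upart th ord0 i <= 0 /\
            forall y, Yk i y -> g i (xpart th) y <= - eps i].

Definition Omega {R : realType} {n m : nat} X f g Yk eps : set 'rV[R]_(n + m) :=
  [set th | forall i : 'I_m, @Omega_i R n m X f g Yk eps i th].

Definition cvec (R : realType) (n m : nat) : 'rV[R]_(n + m) :=
  row_mx 0 (const_mx (m%:R)^-1).

Definition f0 {R : realType} {n m : nat} (th : 'rV[R]_(n + m)) : R :=
  \sum_(k < n + m) @cvec R n m ord0 k * th ord0 k.

Definition Omega_star {R : realType} {n m : nat} X f g Yk eps : set 'rV[R]_(n + m) :=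
  [set th | @Omega R n m X f g Yk eps th /\
            forall th', Omega X f g Yk eps th' -> f0 th <= f0 th'].

Definition ADRCP_feasible {R : realType} {n m : nat} (X : set 'rV[R]_n)
    (g : 'I_m -> 'rV[R]_n -> R -> R) (Yk : 'I_m -> set R) (eps : 'I_m -> R) :=
  [set x | X x /\ forall (i : 'I_m) y, Yk i y -> g i x y <= - eps i].

Definition interior_point_condition {R : realType} {n m : nat} (X : set 'rV[R]_n)
    (g : 'I_m -> 'rV[R]_n -> R -> R) (Yk : 'I_m -> set R) (eps : 'I_m -> R) :=
  ADRCP_feasible X g Yk eps !=set0 /\
  exists xt, ADRCP_feasible X g Yk eps xt /\
    forall (i : 'I_m) y, Yk i y -> g i xt y < - eps i.

(* Main.v *)
(* Every agent moves along the same direction -c, so an unbalanced network is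
   harmless: fix a horizon T and weigh the agents at time t <= T by the stochastic
   vector p(t) with p(T) uniform and p(t) = p(t+1) A(t).  By joint connectivity its
   entries are bounded below uniformly in t and T.  Then the p-weighted mean of
   |theta_i(t) - z|^2, z feasible, decreases by at least a multiple of
     Q(t) = sum of the weighted variances at the mixing step
            + sum of the squared projection residuals,
   up to O(alpha^2), a small multiple of the disagreement D(t), and
   2 alpha (c.theta(t) - c.z).
   Joint connectivity bounds D(t) by the sum of Q + alpha^2 over a window, and the
   Slater point bounds c.theta - c.z, z optimal, below by a multiple of
   - sqrt D(t); hence D and the error terms are summable.
   Divergence of sum alpha then produces a cluster point which is feasible and
   optimal, and taking it for z shows that the whole sequence converges to it. *)
Require Import Defs.
From HB Require Import structures.
From mathcomp Require Import all_boot all_order all_algebra.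
From mathcomp Require Import all_classical all_reals all_analysis.
From mathcomp Require Import ring lra zify.
Import Order.TTheory GRing.Theory Num.Theory.
Import numFieldNormedType.Exports.
Local Open Scope classical_set_scope.
Local Open Scope ring_scope.
Set Implicit Arguments. Unset Strict Implicit. Unset Printing Implicit Defensive.

(** * Euclidean inner product, squared distance and projection *)

Definition dotp {R : realType} {d : nat} (x y : 'rV[R]_d) : R :=
  \sum_(k < d) x ord0 k * y ord0 k.

Lemma dotp_ge0 (R : realType) d (x : 'rV[R]_d) : 0 <= dotp x x.
Proof. by apply: sumr_ge0 => k _; rewrite -expr2 sqr_ge0. Qed.

Lemma dotpDr (R : realType) d (c x y : 'rV[R]_d) :
  dotp c (x + y) = dotp c x + dotp c y.
Proof.
by rewrite -big_split; apply: eq_bigr => k _; rewrite mxE mulrDr.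
Qed.

Lemma dotpZr (R : realType) d (c x : 'rV[R]_d) (a : R) :
  dotp c (a *: x) = a * dotp c x.
Proof.
by rewrite mulr_sumr; apply: eq_bigr => k _; rewrite mxE mulrCA.
Qed.

Lemma dotp0 (R : realType) d (c : 'rV[R]_d) : dotp c 0 = 0.
Proof. by rewrite -(scale0r c) dotpZr mul0r. Qed.

Lemma dotpBr (R : realType) d (c x y : 'rV[R]_d) :
  dotp c (x - y) = dotp c x - dotp c y.
Proof. by rewrite -scaleN1r dotpDr dotpZr mulN1r. Qed.

Lemma sqdist_ge0 (R : realType) d (x y : 'rV[R]_d) : 0 <= sqdist x y.
Proof. by apply: sumr_ge0 => k _; rewrite sqr_ge0. Qed.

Lemma sqdistxx (R : realType) d (x : 'rV[R]_d) : sqdist x x = 0.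
Proof. by apply: big1 => k _; rewrite subrr expr0n. Qed.

Lemma sqdistC (R : realType) d (x y : 'rV[R]_d) : sqdist x y = sqdist y x.
Proof. by apply: eq_bigr => k _; rewrite -sqrrN opprB. Qed.

Lemma sqdist_triangle2 (R : realType) d (y x z : 'rV[R]_d) :
  sqdist x z <= 2 * (sqdist x y + sqdist y z).
Proof.
rewrite -big_split mulr_sumr; apply: ler_sum => k _ /=.
have := sqr_ge0 ((x ord0 k - y ord0 k) - (y ord0 k - z ord0 k)); nra.
Qed.

(** Coordinate by coordinate, the two sides differ by [e * (a * u / e + h) ^+ 2]. This is the price
    of evaluating the cost at another point. *)
Lemma dotp_young (R : realType) d (c x y : 'rV[R]_d) (a e : R) : 0 < e ->
  - (a ^+ 2 * (dotp c c / e) + e * sqdist x y) <= 2 * a * dotp c (x - y).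
Proof.
move=> e0; rewrite mulr_suml !mulr_sumr -big_split -sumrN /=.
apply: ler_sum => k _; rewrite !mxE.
set h := x ord0 k - y ord0 k; set u := c ord0 k.
rewrite -subr_ge0 opprK.
have -> : 2 * a * (u * h) + (a ^+ 2 * (u * u / e) + e * h ^+ 2) =
  e * (a * u / e + h) ^+ 2 by field; rewrite gt_eqF.
by rewrite mulr_ge0 ?sqr_ge0 // ltW.
Qed.

Lemma sqdist_shift (R : realType) d (v c z : 'rV[R]_d) (a : R) :
  sqdist (v - a *: c) z =
  sqdist v z - 2 * a * dotp c (v - z) + a ^+ 2 * dotp c c.
Proof.
rewrite !mulr_sumr -sumrN -!big_split; apply: eq_bigr => k _ /=.
by rewrite !mxE; ring.
Qed.

(** The bias-variance decomposition: with v the mean, (x - z)^2 - (x - v)^2 is affine in x in each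
    coordinate, so its average depends on v only. *)
Lemma sqdist_mean (R : realType) d m (a : 'I_m -> R) (x : 'I_m -> 'rV[R]_d)
  (z : 'rV[R]_d) : \sum_j a j = 1 ->
  \sum_j a j * sqdist (x j) z =
  sqdist (\sum_j a j *: x j) z +
  \sum_j a j * sqdist (x j) (\sum_j a j *: x j).
Proof.
move=> a1; set v := \sum_j a j *: x j.
have vE k : v ord0 k = \sum_j a j * x j ord0 k.
  by rewrite summxE; apply: eq_bigr => j _; rewrite mxE.
apply/eqP; rewrite -subr_eq -sumrB; apply/eqP.
under eq_bigr do rewrite -mulrBr -sumrB mulr_sumr.
rewrite exchange_big; apply: eq_bigr => k _ /=.
transitivity ((v ord0 k - z ord0 k) *
    (2 * (\sum_j a j * x j ord0 k) - (v ord0 k + z ord0 k) * \sum_j a j)).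
  by rewrite !mulr_sumr -sumrB mulr_sumr; apply: eq_bigr => j _; ring.
by rewrite a1 -vE; ring.
Qed.

(** Minimality of [p], tested on the segment from [p] to [z], gives an obtuse angle at [p]. The
    subtracted [sqdist p v] later controls the projection residuals. *)
Lemma proj_obtuse (R : realType) d (K : set 'rV[R]_d) (v p z : 'rV[R]_d) :
  convex_setv K -> is_proj K v p -> K z ->
  sqdist p z <= sqdist v z - sqdist p v.
Proof.
move=> Kc [Kp pmin] Kz.
have vE : sqdist v z = sqdist p v + sqdist p z + 2 * dotp (p - v) (z - p).
  rewrite /sqdist /dotp mulr_sumr -!big_split; apply: eq_bigr => k _ /=.
  by rewrite !mxE; ring.
suff : 0 <= dotp (p - v) (z - p) by rewrite vE; lra.
set a := dotp _ _; rewrite leNgt; apply/negP => a0.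
set b := sqdist p z; have b0 : 0 <= b by exact: sqdist_ge0.
have quad l : 0 <= l <= 1 -> 0 <= l * (2 * a + l * b).
  move=> l01; have := pmin _ (Kc z p l Kz Kp l01).
  rewrite -subr_ge0; congr (_ <= _).
  rewrite /a /b /sqdist /dotp -sumrB !mulr_sumr -big_split mulr_sumr.
  by apply: eq_bigr => k _ /=; rewrite !mxE; ring.
(* For [a < 0] this [l] lies in (0,1] and [l * b < - a], so [2 * a + l * b < 0], against [quad]. *)
pose l := - a / (1 - a + b).
have den0 : 0 < 1 - a + b by lra.
have lE : l * (1 - a + b) = - a by rewrite /l divfK // gt_eqF.
have l0 : 0 < l by rewrite divr_gt0 // oppr_gt0.
have l1 : l <= 1 by rewrite ler_pdivrMr //; lra.
have : 0 <= 2 * a + l * b.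
  by rewrite -(pmulr_rge0 _ l0); apply: quad; rewrite (ltW l0).
nra.
Qed.

Lemma coord_le_norm (R : realType) d (x : 'rV[R]_d) k : `|x ord0 k| <= `|x|.
Proof.
rewrite [leRHS]/Num.norm /= mx_normrE.
by apply/bigmax_geP; right => /=; exists (ord0, k).
Qed.

Lemma norm_le_coord (R : realType) d (x : 'rV[R]_d) (M : R) : 0 <= M ->
  (forall k, `|x ord0 k| <= M) -> `|x| <= M.
Proof.
move=> M0 xM; rewrite [leLHS]/Num.norm /= mx_normrE.
by apply/bigmax_leP; split=> // -[i k] _; rewrite ord1.
Qed.

Lemma norm_le_sqdist (R : realType) d (x y : 'rV[R]_d) :
  `|x - y| <= Num.sqrt (sqdist x y).
Proof.
apply: norm_le_coord => [|k]; first exact: sqrtr_ge0.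
rewrite -sqrtr_sqr ler_wsqrtr // !mxE [leRHS](bigD1 k) //= lerDl.
by apply: sumr_ge0 => j _; rewrite sqr_ge0.
Qed.

Lemma sqdist_le_norm (R : realType) d (x y : 'rV[R]_d) :
  sqdist x y <= d%:R * `|x - y| ^+ 2.
Proof.
apply: (@le_trans _ _ (\sum_(k < d) `|x - y| ^+ 2)).
  apply: ler_sum => k _; rewrite -[leLHS]real_normK ?num_real //.
  rewrite ler_sqr ?nnegrE //.
  by have := coord_le_norm (x - y) k; rewrite !mxE.
by rewrite sumr_const card_ord mulr_natl.
Qed.

(** * Backward weights over a jointly connected network *)

Lemma connect_crossing (T : finType) (e : rel T) (U : {set T}) (x y : T) :
  connect e x y -> x \notin U -> y \in U ->
  exists a b, [/\ a \notin U, b \in U & e a b].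
Proof.
move=> /connectP[p]; elim: p x => [|z p IH] x /=.
  by move=> _ -> /negbTE->.
move=> /andP[exz pz] yE xU yU; have [zU|zU] := boolP (z \in U).
  by exists x, z.
exact: IH pz yE zU yU.
Qed.

(** The recursion p(t) = p(t+1) A(t), run backwards from the uniform vector at time [T]; [k] counts
    steps back, so the value belongs to time [T - k]. *)
Definition pullback_weights {R : realType} {m : nat} (A : nat -> 'M[R]_m)
    (T : nat) (k : nat) : 'I_m -> R :=
  iteri k (fun l p j => \sum_i p i * A (T - l.+1)%N i j) (fun=> m%:R^-1).

Lemma weights_ge0 (R : realType) m (E : nat -> rel 'I_m) (A : nat -> 'M[R]_m) :
  weight_rules E A -> forall t i j, 0 <= A t i j.
Proof.
move=> [AE _] t i j; have [[p1 p2] p3] := AE t i j.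
by have [/p2/ltW//|/negP/p3->] := boolP (E t j i).
Qed.

(* Going back in time, the set of agents known to carry weight at least
   gamma ^ (k S) / m gains an agent in every window of length S. *)
Lemma absolute_probability (R : realType) m (E : nat -> rel 'I_m)
    (A : nat -> 'M[R]_m) : (0 < m)%N -> UJSC E -> weight_rules E A ->
  exists2 eta : R, 0 < eta & forall T, exists p : nat -> 'I_m -> R,
    [/\ forall t i, (t <= T)%N -> eta <= p t i,
        forall t, (t <= T)%N -> \sum_i p t i = 1,
        forall i, p T i = m%:R^-1 &
        forall t j, (t < T)%N -> p t j = \sum_i p t.+1 i * A t i j].
Proof.
move=> m0 [S [S0 conn]] wr; have A0 := weights_ge0 wr.
have [AE [A1 [Eii [g [/andP[g0 g1] Ag]]]]] := wr.
have mR0 : 0 < m%:R :> R by rewrite ltr0n.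
(* Reaching all agents takes at most [m] windows of [S] slots, each slot costs at most a factor [g],
   and the spreading starts from an agent with weight at least the average [m%:R^-1]. *)
exists (g ^+ (m * S) / m%:R); first by rewrite divr_gt0 ?exprn_gt0.
move=> T; exists (fun t => pullback_weights A T (T - t)).
pose p t := pullback_weights A T (T - t);
have pT i : p T i = m%:R^-1 by rewrite /p subnn.
have pS t j : (t < T)%N -> p t j = \sum_i p t.+1 i * A t i j.
  move=> tT; rewrite /p; have -> : (T - t = (T - t.+1).+1)%N by lia.
  rewrite {1}/pullback_weights /=; apply: eq_bigr => i _.
  by congr (_ * A _ _ _); lia.
(* Downward induction on time, starting at [T]. *)
have back (P : nat -> Prop) : P T ->
    (forall t, (t < T)%N -> P t.+1 -> P t) -> forall t, (t <= T)%N -> P t.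
  move=> PT Pt t tT; have -> : t = (T - (T - t))%N by lia.
  elim: (T - t)%N (leq_subr t T) => [|k IH] kT; first by rewrite subn0.
  apply: Pt; first by lia.
  by rewrite -subSn // subSS; apply: IH; lia.
have p0 t i : (t <= T)%N -> 0 <= p t i.
  move=> tT; move: t tT i; apply: back => [i|t tT IH i].
    by rewrite pT invr_ge0 ltW.
  by rewrite pS //; apply: sumr_ge0 => j _; rewrite mulr_ge0.
have p1 t : (t <= T)%N -> \sum_i p t i = 1.
  move: t; apply: back => [|t tT IH].
    rewrite (eq_bigr _ (fun i _ => pT i)) sumr_const card_ord.
    by rewrite -(mulr_natl m%:R^-1 m) divff // gt_eqF.
  rewrite (eq_bigr _ (fun i _ => pS t i tT)) exchange_big /= -[RHS]IH.
  by apply: eq_bigr => i _; rewrite -mulr_sumr A1 mulr1.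
have edge t i j : (t < T)%N -> E t j i -> g * p t.+1 i <= p t j.
  move=> tT Eji; rewrite (pS t) // (bigD1 i) //= mulrC.
  apply: (@le_trans _ _ (p t.+1 i * A t i j)).
    by rewrite ler_wpM2l ?p0 // Ag //; apply/(AE t i j).1.
  by rewrite lerDl; apply: sumr_ge0 => k _; rewrite mulr_ge0 ?p0.
have stay t k i : (t + k <= T)%N -> g ^+ k * p (t + k)%N i <= p t i.
  elim: k => [|k IH] tkT; first by rewrite addn0 mul1r.
  apply: le_trans (IH _); last by lia.
  rewrite exprSr -mulrA ler_wpM2l ?exprn_ge0 ?(ltW g0) // addnS.
  by apply: edge => //; lia.
pose U t k := [set i | g ^+ (k * S) / m%:R <= p t i]%SET.
have UE t k i : (i \in U t k) = (g ^+ (k * S) / m%:R <= p t i) by rewrite inE.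
have grow k : forall t, (t + k * S <= T)%N -> (minn m k.+1 <= #|U t k|)%N.
  elim: k => [|k IH] t tT.
    apply: leq_trans (geq_minr _ _) _; rewrite card_gt0; apply/set0Pn.
    (* The weights sum to 1, so they cannot all be below their average. *)
    apply/existsP; apply: contraT => /existsPn none.
    have tT' : (t <= T)%N by lia.
    have : \sum_i p t i < \sum_(i < m) m%:R^-1.
      apply: ltr_sum => [|i _].
        by apply/hasP; exists (Ordinal m0); rewrite // mem_index_enum.
      by have := none i; rewrite UE mul0n mul1r -ltNge.
    rewrite p1 // sumr_const card_ord -(mulr_natl m%:R^-1 m) divff ?gt_eqF //.
    by rewrite ltxx.
  have sub s i : (t <= s)%N -> (s <= t + S)%N -> i \in U (t + S)%N k ->
      g ^+ (t + S - s) * (g ^+ (k * S) / m%:R) <= p s i.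
    move=> ts sS; rewrite UE => iU.
    have := stay s (t + S - s)%N i; rewrite subnKC //.
    have -> : (t + S <= T)%N by lia.
    move=> /(_ isT); apply: le_trans.
    by rewrite ler_wpM2l // exprn_ge0 // ltW.
  have cE : g ^+ (k.+1 * S) / m%:R = g ^+ S * (g ^+ (k * S) / m%:R).
    by rewrite mulrA -exprD mulSn.
  have subU : U (t + S)%N k \subset U t k.+1.
    apply/fintype.subsetP => i iU; rewrite UE cE.
    by have := sub t i (leqnn _) (leq_addr _ _) iU; rewrite addKn.
  have tkT : (t + S + k * S <= T)%N by lia.
  have {IH} Uk := IH (t + S)%N tkT.
  have [full|notfull] := eqVneq (U (t + S)%N k) [set: 'I_m]%SET.
    rewrite full in subU; apply: leq_trans (geq_minl _ _) _.
    by have := subset_leq_card subU; rewrite cardsT card_ord.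
  have [j jU] : exists j, j \notin U (t + S)%N k.
    apply/existsP; rewrite -negb_forall; apply: contra notfull => /forallP H.
    by apply/eqP/setP => i; rewrite finset.in_setT; exact: H.
  have [i iU] : exists i, i \in U (t + S)%N k.
    apply/set0Pn; rewrite -card_gt0; apply: leq_trans Uk.
    by rewrite leq_min m0.
  (* Some edge of the union graph leads from [a] outside the set to [b] inside it; going back in
     time, [a] inherits weight from [b]. *)
  have [a [b [aU bU /= /existsP[s Eab]]]] :=
    connect_crossing (conn t j i) jU iU.
  have aU' : a \in U t k.+1.
    rewrite UE cE.
    have sS := ltn_ord s.
    have h1 : g ^+ s * p (t + s)%N a <= p t a by apply: stay; lia.
    have h2 : g * p (t + s).+1 b <= p (t + s)%N a by apply: edge => //; lia.
    have h3 := sub (t + s).+1 b ltac:(lia) ltac:(lia) bU.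
    apply: le_trans h1.
    (* The [S] factors: [s] self-loops at [a], the edge itself, and self-loops at [b] in the
       remaining slots. *)
    have -> : g ^+ S = g ^+ (s + (1 + (t + S - (t + s).+1))).
      by congr (_ ^+ _); lia.
    rewrite exprD -!mulrA ler_wpM2l ?exprn_ge0 ?(ltW g0) //.
    by apply: le_trans h2; rewrite exprS -!mulrA ler_wpM2l ?(ltW g0).
  have : (#|U (t + S)%N k| < #|U t k.+1|)%N.
    apply: proper_card; apply/properP; split=> //; by exists a.
  by move=> lt; apply: leq_trans (leq_ltn_trans Uk lt); lia.
suff low : forall t i, (t <= T)%N -> g ^+ (m * S) / m%:R <= p t i by split.
move=> t i tT.
have gX k l : (k <= l)%N -> g ^+ l <= g ^+ k.
  by move=> kl; apply: ler_wiXn2l => //; rewrite ltW.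
have [tm|tm] := leqP (t + m * S) T.
  have := grow m t tm.
  have -> : minn m m.+1 = m by lia.
  move=> Um; have /eqP UT : U t m == [set: 'I_m]%SET.
    by rewrite eqEcard finset.subsetT cardsT card_ord.
  by have := finset.in_setT i; rewrite -UT UE.
(* With fewer than [m * S] slots left, self-loops alone carry the uniform weight back from [T]. *)
have := stay t (T - t)%N i; rewrite subnKC // => /(_ (leqnn _)); rewrite pT.
by apply: le_trans; rewrite ler_wpM2r ?invr_ge0 ?(ltW mR0) // gX; lia.
Qed.

(** * Disagreement bounded by residuals over a window *)

Lemma sqdist_chain (R : realType) d (x : nat -> 'rV[R]_d) (B : R) l :
  0 <= B -> (forall k, (k < l)%N -> sqdist (x k) (x k.+1) <= B) ->
  sqdist (x 0%N) (x l) <= 4 ^+ l * B.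
Proof.
move=> B0; elim: l => [|l IH] xB; first by rewrite sqdistxx mul1r.
apply: (le_trans (sqdist_triangle2 (x l) _ _)).
have h1 := IH (fun k kl => xB k (ltnW kl)).
have h2 := xB l (leqnn _).
(* This turns the bound 2 (4^l B + B) of the triangle inequality into 4^(l+1) B. *)
have : B <= 4 ^+ l * B by rewrite ler_peMl // exprn_ege1 // ler1n.
rewrite exprS -mulrA; lra.
Qed.

(** A path without repetition has at most [#|T|] edges, which makes the constant independent of the
    path. *)
Lemma sqdist_path (R : realType) d (T : finType) (e : rel T)
  (x : T -> 'rV[R]_d) (B : R) a b :
  0 <= B -> (forall a b, e a b -> sqdist (x a) (x b) <= B) ->
  connect e a b -> sqdist (x a) (x b) <= 4 ^+ #|T| * B.
Proof.
move=> B0 xB /connectP[q eq -> {b}]; case: (shortenP eq) => p ep Up _.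
have sp : (size p <= #|T|)%N.
  by apply: ltnW; have := max_card (mem (a :: p)); rewrite (card_uniqP Up).
have chain := @sqdist_chain _ _ (fun k => x (nth a (a :: p) k)) _ (size p) B0.
rewrite (last_nth a); apply: le_trans (chain _) _.
  by move=> k kp; apply: xB; exact: (pathP a ep).
by rewrite ler_wpM2r // ler_weXn2l // ler1n.
Qed.

Definition mixed {R : realType} {d m : nat} (A : nat -> 'M[R]_m)
    (th : 'I_m -> nat -> 'rV[R]_d) (i : 'I_m) (t : nat) : 'rV[R]_d :=
  \sum_(j < m) A t i j *: th j t.

(** The two losses of one iteration: the variance from [sqdist_mean] and the projection gap from
    [proj_obtuse]. *)
Definition residual {R : realType} {d m : nat} (A : nat -> 'M[R]_m)
    (alpha : nat -> R) (c : 'rV[R]_d) (th : 'I_m -> nat -> 'rV[R]_d)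
    (i : 'I_m) (t : nat) : R :=
  \sum_(j < m) A t i j * sqdist (th j t) (mixed A th i t) +
  sqdist (th i t.+1) (mixed A th i t - alpha t *: c).

Definition disagreement {R : realType} {d m : nat}
    (th : 'I_m -> nat -> 'rV[R]_d) (t : nat) : R :=
  \sum_(i < m) \sum_(j < m) sqdist (th i t) (th j t).

Lemma le_sum_term (R : realType) (I : finType) (F : I -> R) (i : I) :
  (forall j, 0 <= F j) -> F i <= \sum_j F j.
Proof. by move=> F0; rewrite (bigD1 i) //= lerDl sumr_ge0. Qed.

Lemma disagreement_ge0 (R : realType) d m (th : 'I_m -> nat -> 'rV[R]_d) t :
  0 <= disagreement th t.
Proof. by do 2!apply: sumr_ge0 => ? _; exact: sqdist_ge0. Qed.

Lemma le_disagreement (R : realType) d m (th : 'I_m -> nat -> 'rV[R]_d) t i j :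
  sqdist (th i t) (th j t) <= disagreement th t.
Proof.
apply: le_trans (le_sum_term i _) => [|k].
  by apply: (le_sum_term j) => k; exact: sqdist_ge0.
by apply: sumr_ge0 => l _; exact: sqdist_ge0.
Qed.

Lemma residual_ge0 (R : realType) d m (E : nat -> rel 'I_m)
    (A : nat -> 'M[R]_m) (alpha : nat -> R) (c : 'rV[R]_d)
    (th : 'I_m -> nat -> 'rV[R]_d) i t :
  weight_rules E A -> 0 <= residual A alpha c th i t.
Proof.
move=> wr; rewrite addr_ge0 ?sqdist_ge0 // sumr_ge0 // => j _.
by rewrite mulr_ge0 ?sqdist_ge0 // (weights_ge0 wr).
Qed.

(** An edge puts sender and receiver near the same mixed point, because its weight is at least [g].
    Agents drift little within a window, so these comparisons can be moved to time [t + S] and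
    chained along a path of the union graph. *)
Lemma disagreement_window (R : realType) d m (E : nat -> rel 'I_m)
    (A : nat -> 'M[R]_m) (alpha : nat -> R) (c : 'rV[R]_d)
    (th : 'I_m -> nat -> 'rV[R]_d) :
  UJSC E -> weight_rules E A ->
  exists S : nat, exists2 C : R, 0 <= C & forall t,
    disagreement th (t + S) <=
    C * \sum_(k < S) (\sum_i residual A alpha c th i (t + k) + alpha (t + k)%N ^+ 2).
Proof.
move=> [S [S0 conn]] wr; have A0 := weights_ge0 wr.
have [AE [A1 [Eii [g [/andP[g0 g1] Ag]]]]] := wr.
pose Q t := \sum_i residual A alpha c th i t.
have res0 i t : 0 <= residual A alpha c th i t by exact: residual_ge0 wr.
have Q0 t : 0 <= Q t by apply: sumr_ge0.
have cc0 := dotp_ge0 c.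
have gV0 : 0 < g^-1 by rewrite invr_gt0.
have near t i j : E t j i -> sqdist (th j t) (mixed A th i t) <= g^-1 * Q t.
  move=> Eji; have Aji : g <= A t i j by apply: Ag; apply/(AE t i j).1.
  rewrite -(ler_pM2l g0) mulrA divff ?gt_eqF // mul1r.
  apply: (@le_trans _ _ (A t i j * sqdist (th j t) (mixed A th i t))).
    by rewrite ler_wpM2r ?sqdist_ge0.
  apply: le_trans (le_sum_term i (res0 ^~ t)).
  rewrite /residual; apply: ler_wpDr; first exact: sqdist_ge0.
  apply: (@le_sum_term _ _ (fun j => A t i j * sqdist (th j t) (mixed A th i t)) j).
  by move=> k; rewrite mulr_ge0 ?sqdist_ge0.
(* Two triangle inequalities along the route from [th i t] through the mixed point and the shifted
   point to [th i t.+1]. *)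
pose C1 := 2 * g^-1 + 4 * dotp c c + 4.
have C10 : 0 <= C1 by rewrite /C1; lra.
have step i t : sqdist (th i t) (th i t.+1) <= C1 * (Q t + alpha t ^+ 2).
  apply: (le_trans (sqdist_triangle2 (mixed A th i t) _ _)).
  have h1 := near t i i (Eii t i).
  have h2 := sqdist_triangle2 (mixed A th i t - alpha t *: c)
    (mixed A th i t) (th i t.+1).
  have h3 : sqdist (mixed A th i t) (mixed A th i t - alpha t *: c) =
      alpha t ^+ 2 * dotp c c.
    by rewrite sqdistC sqdist_shift sqdistxx subrr dotp0; lra.
  have h4 : sqdist (mixed A th i t - alpha t *: c) (th i t.+1) <= Q t.
    rewrite sqdistC; apply: le_trans (le_sum_term i (res0 ^~ t)).
    rewrite /residual lerDr; apply: sumr_ge0 => j _.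
    by rewrite mulr_ge0 ?sqdist_ge0.
  have := Q0 t; have := sqr_ge0 (alpha t); rewrite /C1.
  move: (Q t) (alpha t ^+ 2) (dotp c c) g^-1 h1 h2 h3 h4 cc0 gV0 => *; nra.
(* For an edge at slot [t + s] the route goes back in time along agent [j], across the mixed point
   to agent [i], and forward along agent [i]. *)
pose B := 2 * (4 ^+ S * C1 + 2 * (4 * g^-1 + 4 ^+ S * C1)).
have X0 : 0 <= 4 ^+ S * C1 :> R by rewrite mulr_ge0 ?exprn_ge0.
have B0 : 0 <= B by rewrite /B; lra.
exists S; exists (m%:R * (m%:R * (4 ^+ m * B))).
  by do 3!apply: mulr_ge0 => //; exact: exprn_ge0.
move=> t; set W := \sum_(k < S) _.
have W0 : 0 <= W by apply: sumr_ge0 => k _; rewrite addr_ge0 ?Q0 ?sqr_ge0.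
have QW k : (k < S)%N -> Q (t + k)%N + alpha (t + k)%N ^+ 2 <= W.
  move=> kS; apply: (@le_sum_term _ _
    (fun k : 'I_S => Q (t + k)%N + alpha (t + k)%N ^+ 2) (Ordinal kS)) => j.
  by rewrite addr_ge0 ?Q0 ?sqr_ge0.
have move_ i k : (k <= S)%N ->
    sqdist (th i (t + k)%N) (th i (t + S)%N) <= 4 ^+ S * C1 * W.
  move=> kS; apply: (@le_trans _ _ (4 ^+ (S - k) * (C1 * W))).
    have := @sqdist_chain _ _ (fun l => th i (t + k + l)%N) (C1 * W) (S - k)%N.
    rewrite addn0 -addnA subnKC //; apply; first by rewrite mulr_ge0.
    move=> l lS; rewrite addnS; apply: le_trans (step _ _) _.
    by rewrite ler_wpM2l // -addnA QW //; lia.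
  rewrite -mulrA ler_wpM2r ?mulr_ge0 // ler_weXn2l ?ler1n //.
  exact: leq_subr.
have edge i j : [rel j i | [exists s : 'I_S, E (t + s)%N j i]] j i ->
    sqdist (th j (t + S)%N) (th i (t + S)%N) <= B * W.
  move=> /= /existsP[s Eji]; have sS := ltn_ord s.
  apply: (le_trans (sqdist_triangle2 (th j (t + s)%N) _ _)).
  have h1 := move_ j s (ltnW sS); rewrite sqdistC in h1.
  have h2 := sqdist_triangle2 (th i (t + s)%N) (th j (t + s)%N) (th i (t + S)%N).
  have h3 := move_ i s (ltnW sS).
  have h4 := sqdist_triangle2 (mixed A th i (t + s)) (th j (t + s)%N) (th i (t + s)%N).
  have h5 := near _ _ _ Eji.
  have h6 := near _ _ _ (Eii (t + s)%N i).
  rewrite sqdistC in h6.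
  have h7 : g^-1 * Q (t + s)%N <= g^-1 * W.
    by rewrite ler_pM2l //; have := QW s sS; have := sqr_ge0 (alpha (t + s)%N); lra.
  have -> : B * W = 2 * (4 ^+ S * C1 * W + 2 * (4 * (g^-1 * W) + 4 ^+ S * C1 * W)).
    by rewrite /B; ring.
  lra.
have BW0 : 0 <= B * W by rewrite mulr_ge0.
have sumle (F : 'I_m -> R) b : (forall i, F i <= b) -> \sum_i F i <= m%:R * b.
  move=> Fb; apply: (le_trans (ler_sum _ (fun i _ => Fb i))).
  by rewrite sumr_const card_ord mulr_natl.
rewrite -3!mulrA; apply: (sumle) => i; apply: (sumle) => j.
have := sqdist_path (x := fun i => th i (t + S)%N) BW0
  (fun a b => @edge b a) (conn t i j).
by rewrite card_ord.
Qed.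

(** * The weighted Lyapunov inequality *)

Lemma lyapunov_step (R : realType) d m (A : nat -> 'M[R]_m) (alpha : nat -> R)
    (K : 'I_m -> set 'rV[R]_d) (c z : 'rV[R]_d)
    (th : 'I_m -> nat -> 'rV[R]_d) (i : 'I_m) t :
  (forall t (i : 'I_m), \sum_(j < m) A t i j = 1) ->
  convex_setv (K i) -> K i z ->
  is_proj (K i) (\sum_(j < m) A t i j *: th j t - alpha t *: c) (th i t.+1) ->
  sqdist (th i t.+1) z <= \sum_j A t i j * sqdist (th j t) z
    - residual A alpha c th i t - 2 * alpha t * dotp c (mixed A th i t - z)
    + alpha t ^+ 2 * dotp c c.
Proof.
move=> A1 Kc Kz pr; have := proj_obtuse Kc pr Kz.
rewrite -/(mixed A th i t) sqdist_shift.
have := @sqdist_mean _ _ _ (fun j => A t i j) (th ^~ t) z (A1 t i).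
by rewrite -/(mixed A th i t) /residual; lra.
Qed.

(** The weights depend on the horizon [T], but [eta] does not. They vanish from the statement: at
    [T] they equal [m%:R^-1], at [t1] they are at most 1, and in between they are at least [eta]. *)
Lemma lyapunov_sum (R : realType) d m (E : nat -> rel 'I_m)
    (A : nat -> 'M[R]_m) (alpha : nat -> R)
    (K : 'I_m -> set 'rV[R]_d) (c : 'rV[R]_d)
    (th : 'I_m -> nat -> 'rV[R]_d) (i0 : 'I_m) :
  UJSC E -> weight_rules E A -> (forall i, convex_setv (K i)) ->
  (forall i t, is_proj (K i)
    (\sum_(j < m) A t i j *: th j t - alpha t *: c) (th i t.+1)) ->
  exists2 eta : R, 0 < eta & forall e z, 0 < e -> (forall i, K i z) ->
    forall t1 T, (t1 <= T)%N ->
    m%:R^-1 * (\sum_i sqdist (th i T) z) +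
    \sum_(t1 <= t < T) (eta * (\sum_i residual A alpha c th i t) +
                        2 * alpha t * (dotp c (th i0 t) - dotp c z)) <=
    \sum_i sqdist (th i t1) z +
    \sum_(t1 <= t < T) ((dotp c c + dotp c c / e) * alpha t ^+ 2 +
                        e * disagreement th t).
Proof.
move=> uj wr Kc pr; have A0 := weights_ge0 wr.
have m0 : (0 < m)%N := leq_ltn_trans (leq0n i0) (ltn_ord i0).
have [eta eta0 H] := absolute_probability m0 uj wr.
exists eta => // e z e0 Kz t1 T t1T.
have [p [pl p1 pT pS]] := H T.
have A1 := wr.2.1.
have p0 t i : (t <= T)%N -> 0 <= p t i.
  by move=> tT; apply: le_trans (ltW eta0) (pl _ _ tT).
pose V t := \sum_i p t i * sqdist (th i t) z.
pose Q t := \sum_i residual A alpha c th i t.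
have res0 i t : 0 <= residual A alpha c th i t by exact: residual_ge0 wr.
have step t : (t < T)%N -> V t.+1 <= V t - eta * Q t
    - 2 * alpha t * (dotp c (th i0 t) - dotp c z)
    + ((dotp c c + dotp c c / e) * alpha t ^+ 2 + e * disagreement th t).
  (* [r] is the cost gap of the reference agent [i0] and [s] the error; replacing the mixed point by
     [th i0 t] makes both independent of [i], so averaging with weights of total mass 1 preserves
     [s - r]. *)
  move=> tT; set r := (X in _ - _ - X); set s := (X in _ <= _ + X).
  have stepi i : sqdist (th i t.+1) z <= \sum_j A t i j * sqdist (th j t) z
      - residual A alpha c th i t + (s - r).
    apply: le_trans (lyapunov_step A1 (Kc i) (Kz i) (pr i t)) _.
    have y := dotp_young c (mixed A th i t) (th i0 t) (alpha t) e0.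
    have : sqdist (mixed A th i t) (th i0 t) <= disagreement th t.
      apply: (@le_trans _ _ (\sum_j A t i j * sqdist (th j t) (th i0 t))).
        rewrite (@sqdist_mean _ _ _ (fun j => A t i j) (th ^~ t)) // lerDl.
        by apply: sumr_ge0 => j _; rewrite mulr_ge0 ?sqdist_ge0.
      rewrite -[leRHS]mul1r -(A1 t i) mulr_suml; apply: ler_sum => j _.
      by rewrite ler_wpM2l ?le_disagreement.
    rewrite -(ler_pM2l e0); move: y; rewrite !dotpBr /s /r.
    move: (dotp c c / e) => q.
    move: (sqdist (mixed A th i t) (th i0 t)) => ?.
    lra.
  apply: (@le_trans _ _ (\sum_i p t.+1 i * (\sum_j A t i j * sqdist (th j t) z
      - residual A alpha c th i t + (s - r)))).
    by apply: ler_sum => i _; rewrite ler_wpM2l ?p0.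
  rewrite (eq_bigr (fun i => p t.+1 i * (\sum_j A t i j * sqdist (th j t) z)
    - p t.+1 i * residual A alpha c th i t + p t.+1 i * (s - r))); last first.
    by move=> i _; rewrite mulrDr mulrBr.
  rewrite big_split sumrB /= -mulr_suml p1 // mul1r.
  (* The recursion for [p] closes the inequality for row-stochastic mixing. *)
  have -> : \sum_i p t.+1 i * (\sum_j A t i j * sqdist (th j t) z) = V t.
    under eq_bigr do rewrite mulr_sumr.
    rewrite exchange_big; apply: eq_bigr => j _ /=.
    by rewrite pS // mulr_suml; apply: eq_bigr => i _; rewrite mulrA.
  suff : eta * Q t <= \sum_i p t.+1 i * residual A alpha c th i t by lra.
  by rewrite mulr_sumr; apply: ler_sum => i _; rewrite ler_wpM2r ?pl.
have -> : m%:R^-1 * (\sum_i sqdist (th i T) z) = V T.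
  by rewrite mulr_sumr; apply: eq_bigr => i _; rewrite pT.
have : V t1 <= \sum_i sqdist (th i t1) z.
  apply: ler_sum => i _; rewrite ler_piMl ?sqdist_ge0 // -(p1 _ t1T).
  by apply: (@le_sum_term _ _ (p t1)) => j; exact: p0.
suff IH k : (t1 <= k)%N -> (k <= T)%N -> V k + \sum_(t1 <= t < k) (eta * Q t +
    2 * alpha t * (dotp c (th i0 t) - dotp c z)) <=
  V t1 + \sum_(t1 <= t < k) ((dotp c c + dotp c c / e) * alpha t ^+ 2 +
                        e * disagreement th t).
  by have := IH T t1T (leqnn T); lra.
elim: k => [|k IH].
  by rewrite leqn0 => /eqP-> _; rewrite !big_geq.
rewrite leq_eqVlt => /predU1P[<- _|]; first by rewrite !big_geq.
rewrite ltnS => t1k kT; rewrite !big_nat_recr //=.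
by have := IH t1k (ltnW kT); have := step k kT; lra.
Qed.

(** * Summable disagreement and convergence for general closed convex sets *)

(** The window bound controls the sum of D by that of Q, and the Lyapunov bound controls the sum of
    Q by [e] times that of D; a small [e] closes the loop. *)
Lemma disagreement_summable (R : realType) d m (E : nat -> rel 'I_m)
    (A : nat -> 'M[R]_m) (alpha : nat -> R)
    (K : 'I_m -> set 'rV[R]_d) (c z : 'rV[R]_d) (kappa : R)
    (th : 'I_m -> nat -> 'rV[R]_d) (i0 : 'I_m) :
  UJSC E -> weight_rules E A -> (forall i, convex_setv (K i)) ->
  (forall i t, is_proj (K i)
    (\sum_(j < m) A t i j *: th j t - alpha t *: c) (th i t.+1)) ->
  (forall i, K i z) ->
  (forall e, 0 < e -> forall t,
    - (e * disagreement th t + kappa / e * alpha t ^+ 2) <=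
    2 * alpha t * (dotp c (th i0 t) - dotp c z)) ->
  (exists B, forall T, \sum_(0 <= t < T) alpha t ^+ 2 <= B) ->
  exists B, forall T, \sum_(0 <= t < T) disagreement th t <= B.
Proof.
move=> uj wr Kc pr Kz reg [Ba aB].
have [eta eta0 lyap] := lyapunov_sum i0 uj wr Kc pr.
have [S [C C0 win]] := disagreement_window alpha c th uj wr.
pose Q t := \sum_i residual A alpha c th i t.
have Q0 t : 0 <= Q t by apply: sumr_ge0 => i _; exact: residual_ge0 wr.
have D0 t := @disagreement_ge0 _ _ _ th t.
pose D T := \sum_(0 <= t < T) disagreement th t.
pose SQ T := \sum_(0 <= t < T) Q t.
have mono (u : nat -> R) T T' : (forall t, 0 <= u t) -> (T <= T')%N ->
    \sum_(0 <= t < T) u t <= \sum_(0 <= t < T') u t.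
  move=> u0 TT'; rewrite [leRHS](big_cat_nat (n := T)) //= lerDl.
  by apply: sumr_ge0.
have DB T : D (T + S)%N <= D S + C * S%:R * (SQ (T + S)%N + Ba).
  rewrite /D (big_cat_nat (n := S)) ?leq_addl //= lerD2l.
  rewrite -{1}(add0n S) big_addn addnK.
  apply: (le_trans (ler_sum _ (fun t _ => win t))).
  rewrite -mulr_sumr exchange_big -mulrA ler_wpM2l //=.
  have -> : S%:R * (SQ (T + S)%N + Ba) = \sum_(k < S) (SQ (T + S)%N + Ba).
    by rewrite sumr_const card_ord mulr_natl.
  apply: ler_sum => k _.
  apply: (@le_trans _ _ (\sum_(0 <= t < T + S) (Q t + alpha t ^+ 2))); last first.
    by rewrite big_split lerD2l aB.
  apply: (@le_trans _ _ (\sum_(k <= t < T + k) (Q t + alpha t ^+ 2))).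
    suff -> : \sum_(k <= t < T + k) (Q t + alpha t ^+ 2) =
      \sum_(0 <= t < T) (Q (t + k)%N + alpha (t + k)%N ^+ 2) by [].
    by rewrite -{1}(add0n k) big_addn addnK.
  apply: (@le_trans _ _ (\sum_(0 <= t < T + k) (Q t + alpha t ^+ 2))).
    rewrite [leRHS](big_cat_nat (n := k)) ?leq_addl //= lerDr.
    by apply: sumr_ge0 => t _; rewrite addr_ge0 ?sqr_ge0.
  apply: mono => [t|]; first by rewrite addr_ge0 ?sqr_ge0.
  by rewrite leq_add2l ltnW.
pose x : R := C * S%:R.
have x0 : 0 <= x by rewrite mulr_ge0.
(* One [e] comes from the Lyapunov error and one from the lower bound on the cost gap. After
   substituting [DB], the sum of Q returns with coefficient [2 * e * x], at most half of [eta], and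
   is absorbed. *)
pose e := eta / (4 * (x + 1)).
have e0 : 0 < e by rewrite divr_gt0 // mulr_gt0 // ltr_wpDl.
have ex : 2 * e * x <= eta / 2.
  have -> : eta / 2 = 2 * e * (x + 1) by rewrite /e; field; rewrite gt_eqF // ltr_wpDl.
  by rewrite ler_wpM2l ?lerDl // mulr_ge0 // ltW.
pose V0 := \sum_i sqdist (th i 0%N) z.
(* The total coefficient of the squared stepsizes; [kappa] may have any sign here, hence the
   absolute value below. *)
pose M := dotp c c + dotp c c / e + kappa / e.
have main T : eta * SQ T <= V0 + `|M| * Ba + 2 * e * D T.
  have := lyap e z e0 Kz 0%N T (leq0n T).
  have h1 : 0 <= m%:R^-1 * (\sum_i sqdist (th i T) z).
    by rewrite mulr_ge0 ?invr_ge0 // sumr_ge0 // => i _; exact: sqdist_ge0.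
  have h2 : eta * SQ T - (e * D T + kappa / e * \sum_(0 <= t < T) alpha t ^+ 2) <=
    \sum_(0 <= t < T) (eta * Q t + 2 * alpha t * (dotp c (th i0 t) - dotp c z)).
    rewrite /SQ /D !mulr_sumr -big_split -sumrB; apply: ler_sum => t _ /=.
    by rewrite lerD2l reg.
  have h3 : \sum_(0 <= t < T) ((dotp c c + dotp c c / e) * alpha t ^+ 2 +
      e * disagreement th t) =
    (dotp c c + dotp c c / e) * (\sum_(0 <= t < T) alpha t ^+ 2) + e * D T.
    by rewrite big_split !mulr_sumr.
  have h4 : M * (\sum_(0 <= t < T) alpha t ^+ 2) <= `|M| * Ba.
    have s0 : 0 <= \sum_(0 <= t < T) alpha t ^+ 2.
      by apply: sumr_ge0 => t _; exact: sqr_ge0.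
    apply: (@le_trans _ _ (`|M| * (\sum_(0 <= t < T) alpha t ^+ 2))).
      by rewrite ler_wpM2r // ler_norm.
    by rewrite ler_wpM2l.
  move: h2 h4; rewrite h3 -/V0 /M /Q; lra.
exists (D S + x * (2 / eta * (V0 + `|M| * Ba + 2 * e * (D S + x * Ba)) + Ba)) => T.
apply: (@le_trans _ _ (D (T + S)%N)); first by apply: mono; rewrite // leq_addr.
apply: le_trans (DB T) _; rewrite lerD2l ler_wpM2l // lerD2r.
have q0 : 0 <= SQ (T + S)%N by apply: sumr_ge0.
have h1 := ler_wpM2r q0 ex.
have h2 : 2 * e * D (T + S)%N <= 2 * e * (D S + x * (SQ (T + S)%N + Ba)).
  by rewrite ler_wpM2l ?DB // mulr_ge0 // ltW.
have h3 := main (T + S)%N.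
rewrite [leRHS]mulrC -[2 / eta]invf_div ler_pdivlMr ?divr_gt0 //.
move: (D S) (SQ _) (D _) (V0 + _) h1 h2 h3 => *; lra.
Qed.

Lemma tail_small (R : realType) (u : nat -> R) (B : R) :
  (forall t, 0 <= u t) -> (forall T, \sum_(0 <= t < T) u t <= B) ->
  forall e, 0 < e ->
  exists N, forall s T, (N <= s)%N -> \sum_(s <= t < T) u t <= e.
Proof.
move=> u0 uB e e0; pose P := range (fun T => \sum_(0 <= t < T) u t).
have hP : has_sup P.
  by split; [exists (\sum_(0 <= t < 0) u t); exists 0%N
            |exists B => _ [T _ <-]; exact: uB].
have [_ [N _ <-] Ne] := sup_adherent e0 hP.
exists N => s T Ns; have [sT|Ts] := leqP s T; last first.
  by rewrite big_geq ?(ltW e0) // ltnW.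
have : \sum_(0 <= t < T) u t <= sup P by apply: sup_upper_bound => //; exists T.
rewrite (big_cat_nat (n := s)) //= (big_cat_nat (n := N) (p := s)) //=.
have : 0 <= \sum_(N <= t < s) u t by apply: sumr_ge0.
by move: Ne; lra.
Qed.

Lemma dotp_lipschitz (R : realType) d (c x y : 'rV[R]_d) :
  `|dotp c x - dotp c y| <= (\sum_k `|c ord0 k|) * `|x - y|.
Proof.
rewrite -dotpBr mulr_suml; apply: le_trans (ler_norm_sum _ _ _) _.
apply: ler_sum => k _; rewrite normrM ler_wpM2l //.
exact: coord_le_norm.
Qed.

(** The epigraph structure enters only through the last hypothesis, the lower bound on the cost gap;
    [z] is a comparison point. *)
Lemma distributed_projection_cvg (R : realType) d m (E : nat -> rel 'I_m)
    (A : nat -> 'M[R]_m) (alpha : nat -> R)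
    (K : 'I_m -> set 'rV[R]_d) (c z : 'rV[R]_d) (kappa : R)
    (th : 'I_m -> nat -> 'rV[R]_d) (i0 : 'I_m) :
  UJSC E -> weight_rules E A ->
  (forall i, convex_setv (K i)) -> (forall i, closed (K i)) ->
  (forall t, 0 < alpha t) ->
  (exists B, forall T, \sum_(0 <= t < T) alpha t ^+ 2 <= B) ->
  (forall B, exists T, B < \sum_(0 <= t < T) alpha t) ->
  (forall i t, K i (th i t)) ->
  (forall i t, is_proj (K i)
    (\sum_(j < m) A t i j *: th j t - alpha t *: c) (th i t.+1)) ->
  (forall i, K i z) -> 0 <= kappa ->
  (forall t, - (kappa * Num.sqrt (disagreement th t)) <=
     dotp c (th i0 t) - dotp c z) ->
  exists ths, [/\ forall i, K i ths, dotp c ths <= dotp c z &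
    forall i, th i t @[t --> \oo] --> ths].
Proof.
move=> uj wr Kc Kcl a0 aB aoo Kth pr Kz kap0 reg.
have D0 t := @disagreement_ge0 _ _ _ th t.
have reg2 e t : 0 < e -> - (e * disagreement th t + kappa ^+ 2 / e * alpha t ^+ 2) <=
    2 * alpha t * (dotp c (th i0 t) - dotp c z).
  move=> e0; set s := Num.sqrt (disagreement th t).
  have sE : disagreement th t = s ^+ 2 by rewrite sqr_sqrtr.
  have h1 : - (2 * alpha t * (kappa * s)) <=
      2 * alpha t * (dotp c (th i0 t) - dotp c z).
    by rewrite -mulrN ler_wpM2l ?reg // mulr_ge0 // ltW.
  apply: le_trans h1; rewrite lerN2 sE -subr_ge0.
  have -> : e * s ^+ 2 + kappa ^+ 2 / e * alpha t ^+ 2 - 2 * alpha t * (kappa * s)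
    = e * (s - kappa * alpha t / e) ^+ 2 by field; rewrite gt_eqF.
  by rewrite mulr_ge0 ?sqr_ge0 // ltW.
have [BD DB] := disagreement_summable uj wr Kc pr Kz (fun e e0 t => reg2 e t e0) aB.
have [eta eta0 lyap] := lyapunov_sum i0 uj wr Kc pr.
have [Ba aBa] := aB.
have m0 : (0 < m)%N := leq_ltn_trans (leq0n i0) (ltn_ord i0).
have mV0 : 0 < m%:R^-1 :> R by rewrite invr_gt0 ltr0n.
(* The Lyapunov inequality is used with [e = 1]. Adding [kappa ^+ 2 * alpha t ^+ 2 + disagreement th
   t] to both sides makes the summands on the left nonnegative, and [w] is the resulting summable
   error. *)
pose M := dotp c c + dotp c c + kappa ^+ 2.
have M0 : 0 <= M by rewrite !addr_ge0 ?dotp_ge0 ?sqr_ge0.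
pose w t := M * alpha t ^+ 2 + 2 * disagreement th t.
have w0 t : 0 <= w t.
  by apply: addr_ge0; apply: mulr_ge0 => //; exact: sqr_ge0.
have wB T : \sum_(0 <= t < T) w t <= M * Ba + 2 * BD.
  by rewrite big_split -!mulr_sumr lerD // ler_wpM2l.
pose V y t := \sum_i sqdist (th i t) y.
have V0 y t : 0 <= V y t by apply: sumr_ge0 => i _; exact: sqdist_ge0.
pose h t := dotp c (th i0 t) - dotp c z.
(* [y = z] serves for boundedness and small cost gaps, [y = ths] for convergence of the whole
   sequence. *)
have fejer y t1 T : (forall i, K i y) -> dotp c y <= dotp c z -> (t1 <= T)%N ->
    m%:R^-1 * V y T + \sum_(t1 <= t < T)
      (2 * alpha t * h t + kappa ^+ 2 * alpha t ^+ 2 + disagreement th t)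
    <= V y t1 + \sum_(t1 <= t < T) w t.
  move=> Ky cy t1T; have := lyap 1 y ltr01 Ky t1 T t1T.
  rewrite -/(V y T) -/(V y t1) divr1 => L.
  rewrite -lerBrDr -addrA -sumrB.
  rewrite -lerBrDr -addrA -sumrB in L.
  apply: le_trans L _; rewrite lerD2l; apply: ler_sum => t _.
  have : 0 <= eta * \sum_i residual A alpha c th i t.
    by apply: mulr_ge0; [exact: ltW|apply: sumr_ge0 => i _; exact: residual_ge0 wr].
  have : 2 * alpha t * h t <= 2 * alpha t * (dotp c (th i0 t) - dotp c y).
    by rewrite ler_wpM2l ?lerD2l ?lerN2 // mulr_ge0 // ltW.
  by rewrite /w /M; lra.
have lo t : 0 <= 2 * alpha t * h t + kappa ^+ 2 * alpha t ^+ 2 + disagreement th t.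
  by have := reg2 1 t ltr01; rewrite divr1 /h; lra.
have fejer0 y t1 T : (forall i, K i y) -> dotp c y <= dotp c z -> (t1 <= T)%N ->
    m%:R^-1 * V y T <= V y t1 + \sum_(t1 <= t < T) w t.
  move=> Ky cy t1T; apply: le_trans (fejer y t1 T Ky cy t1T).
  by rewrite lerDl sumr_ge0.
have Dsmall e : 0 < e -> exists N, forall t, (N <= t)%N -> disagreement th t <= e.
  move=> e0; have [N HN] := tail_small D0 DB e0.
  by exists N => t Nt; have := HN t t.+1 Nt; rewrite big_nat1.
have hsmall e N : 0 < e -> exists2 t, (N <= t)%N & h t < e.
  (* A gap of at least [e] from [N] on would bound the stepsize sum after [N] by [Z]. *)
  move=> e0; apply: contrapT => none.
  have he t : (N <= t)%N -> e <= h t.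
    by move=> Nt; rewrite leNgt; apply/negP => lt; apply: none; exists t.
  pose Z := (V z N + (M * Ba + 2 * BD)) / (2 * e).
  have [T] := aoo (\sum_(0 <= t < N) alpha t + Z).
  apply/negP; rewrite -leNgt; have [NT|TN] := leqP N T; last first.
    apply: ler_wpDr; last first.
      rewrite [leRHS](big_cat_nat (n := T)) ?(ltnW TN) //= lerDl.
      by apply: sumr_ge0 => t _; exact: ltW.
    rewrite divr_ge0 ?mulr_ge0 ?(ltW e0) // addr_ge0 //.
    by apply: le_trans (wB 0%N); rewrite big_geq.
  rewrite (big_cat_nat (n := N)) //= lerD2l ler_pdivlMr ?mulr_gt0 //.
  have := fejer z N T Kz (lexx _) NT.
  have : \sum_(N <= t < T) w t <= M * Ba + 2 * BD.
    apply: le_trans (wB T); rewrite [leRHS](big_cat_nat (n := N)) //= lerDr.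
    by apply: sumr_ge0.
  have : 0 <= m%:R^-1 * V z T by rewrite mulr_ge0 // ltW.
  suff : (\sum_(N <= t < T) alpha t) * (2 * e) <= \sum_(N <= t < T)
      (2 * alpha t * h t + kappa ^+ 2 * alpha t ^+ 2 + disagreement th t) by lra.
  rewrite mulr_suml; apply: ler_sum_nat => t /andP[Nt _].
  have h1 := he t Nt; have h2 := D0 t; have h3 := a0 t.
  have h4 : 0 <= kappa ^+ 2 * alpha t ^+ 2 by rewrite mulr_ge0 ?sqr_ge0.
  have h5 : alpha t * e <= alpha t * h t by rewrite ler_wpM2l // ltW.
  lra.
have bnd t : `|th i0 t - z| <= Num.sqrt (m%:R * (V z 0%N + (M * Ba + 2 * BD))).
  apply: le_trans (norm_le_sqdist _ _) _; rewrite ler_wsqrtr //.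
  apply: (@le_trans _ _ (V z t)).
    by apply: (@le_sum_term _ _ (fun i => sqdist (th i t) z)) => i; exact: sqdist_ge0.
  rewrite -ler_pdivrMl ?ltr0n //.
  by apply: le_trans (fejer0 z 0%N t Kz (lexx _) (leq0n _)) _; rewrite lerD2l.
(* The gap is small at arbitrarily late times and the disagreement at all late times, so one time
   serves both. *)
have sub k : exists t, [/\ (k <= t)%N, h t < k.+1%:R^-1 &
    disagreement th t <= k.+1%:R^-1].
  have k0 : 0 < k.+1%:R^-1 :> R by rewrite invr_gt0.
  have [N DN] := Dsmall _ k0.
  have [t] := hsmall _ (maxn k N) k0; rewrite geq_max => /andP[kt Nt] ht.
  by exists t; split=> //; exact: DN.
have [s sP] := boolp.choice sub.
set r := Num.sqrt _ in bnd.
have [ths clus] : exists ths, forall e N, 0 < e -> exists2 k, (N <= k)%N &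
    `|th i0 (s k) - ths| < e.
  have comp : compact (closed_ball_ (fun x : 'rV[R]_d => `|x|) z r).
    apply: bounded_closed_compact.
      exists (`|z| + r); split=> [|M' /ltW rM x /= zx]; first exact: num_real.
      apply: le_trans rM; rewrite -[x](subrK z) addrC.
      by apply: le_trans (ler_normD _ _) _; rewrite lerD2l distrC.
    exact: closed_closed_ball_.
  have inball : ((fun k => th i0 (s k)) @ \oo)
      (closed_ball_ (fun x : 'rV[R]_d => `|x|) z r).
    by exists 0%N => // k _; rewrite /closed_ball_ /= distrC; exact: bnd.
  have [x [_ xcl]] := comp _ _ inball.
  exists x => e N e0.
  have [||y [[k Nk <-]]] := xcl [set y | exists2 k, (N <= k)%N & th i0 (s k) = y]
      [set y | `|y - x| < e].
  - by exists N => // k Nk; exists k.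
  - by apply/nbhs_ballP; exists e => //= y; rewrite -ball_normE /= distrC.
  by exists k.
have approx e N : 0 < e -> exists t, [/\ (N <= t)%N, h t < e &
    forall i, `|th i t - ths| < e].
  move=> e0; have e2 : 0 < e / 2 by rewrite divr_gt0.
  have d0 : 0 < Num.min e ((e / 2) ^+ 2) by rewrite lt_min e0 exprn_gt0.
  have [N1 _ HN1] := near_infty_natSinv_lt (PosNum d0).
  have [k] := clus _ (maxn N N1) e2; rewrite geq_max => /andP[Nk N1k] thk.
  have [kt hk Dk] := sP k.
  have := HN1 k N1k; rewrite /= lt_min => /andP[ke ke2].
  exists (s k); split; [exact: leq_trans kt|exact: lt_trans ke|move=> i].
  rewrite -[_ - _](subrKA (th i0 (s k))); apply: le_lt_trans (ler_normD _ _) _.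
  rewrite [e]splitr; apply: ler_ltD thk.
  apply: le_trans (norm_le_sqdist _ _) _.
  rewrite -[leRHS](ger0_norm (ltW e2)) -sqrtr_sqr ler_wsqrtr //.
  apply: le_trans (le_disagreement _ _ _ _) _.
  by apply: le_trans Dk _; exact: ltW.
have Kths i : K i ths.
  apply: Kcl => U /nbhs_ballP[e /= e0 eU].
  have [t [_ _ ti]] := approx _ 0%N e0.
  exists (th i t); split=> //; apply: eU.
  by rewrite -ball_normE /= distrC.
have cths : dotp c ths <= dotp c z.
  pose L := \sum_k `|c ord0 k|.
  have L0 : 0 <= L by apply: sumr_ge0.
  apply/ler_addgt0Pr => e e0.
  have e1 : 0 < e / (1 + L) by rewrite divr_gt0 // ltr_wpDr.
  have [t [_ ht ti]] := approx _ 0%N e1.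
  have := le_trans (ler_norm _) (dotp_lipschitz c ths (th i0 t)).
  have : L * `|ths - th i0 t| <= L * (e / (1 + L)).
    by rewrite ler_wpM2l // distrC ltW.
  have : e = e / (1 + L) + L * (e / (1 + L)).
    by field; rewrite gt_eqF // ltr_wpDr.
  by move: ht; rewrite /h -/L; lra.
exists ths; split=> // i; apply/cvgrPdist_le => e e0.
(* One half of the budget is for [V ths t1], the other for the tail of [w]; [m%:R^-1] matches the
   factor in [fejer0]. *)
pose q := m%:R^-1 * e ^+ 2 / 2.
have q0 : 0 < q by rewrite divr_gt0 // mulr_gt0 // exprn_gt0.
have [N HN] := tail_small w0 wB q0.
(* The summand 1 keeps [n0] positive also for [d = 0]. *)
pose n0 : R := 1 + m%:R * d%:R.
have n00 : 0 < n0 by rewrite ltr_wpDr // mulr_ge0.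
have r0 : 0 < Num.sqrt (q / n0) by rewrite sqrtr_gt0 divr_gt0.
have [t1 [Nt1 _ t1P]] := approx _ N r0.
have Vt1 : V ths t1 <= q.
  apply: (@le_trans _ _ (\sum_(i < m) d%:R * (q / n0))).
    apply: ler_sum => j _; apply: le_trans (sqdist_le_norm _ _) _.
    rewrite ler_wpM2l // -[leRHS]sqr_sqrtr ?(ltW (divr_gt0 q0 n00)) //.
    by rewrite ler_sqr ?nnegrE ?sqrtr_ge0 // ltW.
  rewrite sumr_const card_ord -[leLHS]mulr_natl.
  have -> : m%:R * (d%:R * (q / n0)) = q * (m%:R * d%:R / n0) by ring.
  rewrite ler_piMr ?(ltW q0) //.
  by rewrite ler_pdivrMr // mul1r /n0 lerDr.
exists t1 => // t /= t1t.
rewrite distrC; apply: le_trans (norm_le_sqdist _ _) _.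
rewrite -[leRHS](ger0_norm (ltW e0)) -sqrtr_sqr ler_wsqrtr //.
apply: (@le_trans _ _ (V ths t)).
  by apply: (@le_sum_term _ _ (fun i => sqdist (th i t) ths)) => j; exact: sqdist_ge0.
rewrite -(ler_pM2l mV0).
have := fejer0 ths t1 t Kths cths t1t.
have := HN t1 t Nt1.
have : m%:R^-1 * e ^+ 2 = q + q by rewrite /q -splitr.
lra.
Qed.

(** * Local Lipschitz continuity of convex functions *)

Lemma convex_fun_segment (R : realType) d (f : 'rV[R]_d -> R) v (s : R) :
  convex_fun f -> `|s| <= 1 -> f (s *: v) <= Num.max (f v) (f (- v)).
Proof.
rewrite ler_norml => fc /andP[s1 s2].
pose l := (s + 1) / 2; have l01 : 0 <= l <= 1 by rewrite /l; lra.
have -> : s *: v = l *: v + (1 - l) *: (- v).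
  by rewrite scalerN -scalerBl; congr (_ *: _); rewrite /l; lra.
apply: le_trans (fc _ _ _ l01) _; case/andP: l01 => l0 l1.
set b := Num.max _ _; have h1 : f v <= b by rewrite le_max lexx.
have h2 : f (- v) <= b by rewrite le_max lexx orbT.
nra.
Qed.

(* Induction on the number of nonvanishing coordinates: x is the midpoint of a
   point on the last axis and of a point with one coordinate less. *)
Lemma convex_fun_bounded_above (R : realType) d (f : 'rV[R]_d -> R) (B : R) :
  convex_fun f -> 0 < B -> exists M, forall x, `|x| <= B -> f x <= M.
Proof.
move=> fc B0.
suff H k : forall B, 0 < B -> exists M, forall x : 'rV[R]_d, `|x| <= B ->
    (forall j : 'I_d, (k <= j)%N -> x ord0 j = 0) -> f x <= M.
  have [M fM] := H d B B0; exists M => x xB; apply: fM => // j.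
  by rewrite leqNgt ltn_ord.
elim: k => {B B0} [|k IH] B B0.
  exists (f 0) => x _ x0; suff -> : x = 0 by [].
  by apply/rowP => j; rewrite x0 ?mxE.
(* The point with one coordinate less is doubled to make [x] a midpoint, so the radius doubles
   too. *)
have B20 : 0 < 2 * B by lra.
have [M1 fM1] := IH (2 * B) B20.
have [kd|dk] := ltnP k d; last first.
  exists M1 => x xB x0; apply: fM1 => [|j kj].
    by apply: le_trans xB _; lra.
  by have := leq_trans dk kj; rewrite leqNgt ltn_ord.
pose j0 := Ordinal kd.
pose v : 'rV[R]_d := (2 * B) *: delta_mx ord0 j0.
exists (2^-1 * Num.max (f v) (f (- v)) + (1 - 2^-1) * M1) => x xB x0.
pose x' := x - x ord0 j0 *: delta_mx ord0 j0.
pose s := x ord0 j0 / B.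
have -> : x = 2^-1 *: (s *: v) + (1 - 2^-1) *: (2 *: x').
  have -> : 2^-1 *: (s *: v) = x ord0 j0 *: delta_mx ord0 j0.
    by rewrite /v !scalerA /s; congr (_ *: _); field; rewrite gt_eqF.
  have -> : (1 - 2^-1) *: (2 *: x') = x'.
    by rewrite scalerA (_ : _ * 2 = 1) ?scale1r //; field.
  by rewrite addrC subrK.
have x'E j : x' ord0 j = if j == j0 then 0 else x ord0 j.
  rewrite !mxE eqxx /= eq_sym; case: eqVneq => [<-|_]; first by rewrite mulr1 subrr.
  by rewrite mulr0 subr0.
apply: le_trans (fc _ _ _ _) _; first by lra.
have h1 : f (s *: v) <= Num.max (f v) (f (- v)).
  apply: convex_fun_segment => //; rewrite normrM normfV (gtr0_norm B0).
  by rewrite ler_pdivrMr // mul1r (le_trans (coord_le_norm _ _)).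
have h2 : f (2 *: x') <= M1.
  apply: fM1 => [|j kj].
    rewrite normrZ ger0_norm // ler_pM2l //.
    apply: norm_le_coord => [|j]; first exact: ltW.
    rewrite x'E; case: ifP => _; first by rewrite normr0 ltW.
    exact: le_trans (coord_le_norm _ _) xB.
  rewrite mxE x'E; case: eqVneq => [_|jj0]; first by rewrite mulr0.
  rewrite x0 ?mulr0 // ltn_neqAle kj andbT; apply: contra jj0 => /eqP kE.
  by apply/eqP/val_inj.
lra.
Qed.

(** Midpoint convexity at the origin turns the upper bound on a larger ball into a lower bound;
    slopes are then bounded by the oscillation over a unit step. *)
Lemma convex_fun_lipschitz (R : realType) d (f : 'rV[R]_d -> R) (B : R) :
  convex_fun f -> 0 < B -> exists2 L, 0 <= L &
    forall x y, `|x| <= B -> `|y| <= B -> `|f x - f y| <= L * `|x - y|.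
Proof.
move=> fc B0; have B10 : 0 < B + 1 by lra.
have [M fM] := convex_fun_bounded_above fc B10.
have lo x : `|x| <= B + 1 -> 2 * f 0 - M <= f x.
  move=> xB; have := fM (- x); rewrite normrN => /(_ xB).
  have h : 0 <= (2^-1 : R) <= 1 by lra.
  have := fc x (- x) 2^-1 h.
  rewrite scalerN -scalerBl (_ : 2^-1 - (1 - 2^-1) = 0) ?scale0r; last by field.
  lra.
pose L := 2 * M - 2 * f 0.
have fM0 : f 0 <= M by apply: fM; rewrite normr0 ltW.
have L0 : 0 <= L by rewrite /L; lra.
(* f is compared at x, y and the point at distance 1 beyond y on the ray from x *)
have half x y : `|x| <= B -> `|y| <= B -> f y - f x <= L * `|x - y|.
  move=> xB yB; have [->|nxy] := eqVneq x y; first by rewrite !subrr normr0 mulr0.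
  set r := `|x - y|; have r0 : 0 < r by rewrite normr_gt0 subr_eq0.
  pose z := y + r^-1 *: (y - x).
  have zB : `|z| <= B + 1.
    apply: le_trans (ler_normD _ _) _; apply: lerD => //.
    by rewrite normrZ normfV (gtr0_norm r0) distrC mulVf ?gt_eqF.
  (* [y] lies on the segment from [x] to [z], of length [r + 1], at distance [r] from [x]. *)
  pose l := r / (1 + r); have l01 : 0 <= l <= 1.
    rewrite /l divr_ge0 ?ler_pdivrMr ?mul1r /=; lra.
  have yE : y = l *: z + (1 - l) *: x.
    apply/rowP => k; rewrite !mxE /l; field; rewrite !gt_eqF //; lra.
  have fy := fc z x l l01; rewrite -yE in fy.
  have := fM z zB; have xB1 : `|x| <= B + 1 by lra.
  have := lo x xB1 => lox fz.
  have lr : l <= r.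
    by rewrite /l ler_pdivrMr ?ler_peMr //; lra.
  have h1 : l * (f z - f x) <= l * L.
    by case/andP: l01 => l0 _; rewrite ler_wpM2l // /L; lra.
  have h2 : l * L <= r * L by rewrite ler_wpM2r.
  rewrite (mulrC L); lra.
exists L => // x y xB yB; rewrite ler_norml.
have := half x y xB yB; have := half y x yB xB; rewrite (distrC y x); lra.
Qed.

Lemma convex_fun_continuous (R : realType) d (f : 'rV[R]_d -> R) :
  convex_fun f -> continuous f.
Proof.
move=> fc x; apply/(@cvgrPdist_le _ _ _ (nbhs x) (nbhs_filter x)) => e e0.
have B0 : 0 < `|x| + 1 by rewrite ltr_wpDl.
have [L L0 fL] := convex_fun_lipschitz fc B0.
have d0 : 0 < Num.min 1 (e / (1 + L)).
  by rewrite lt_min ltr01 divr_gt0 // ltr_wpDr.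
apply/nbhs_ballP; exists (Num.min 1 (e / (1 + L))) => //= y.
rewrite -ball_normE /= lt_min => /andP[xy1 xye].
apply: le_trans (fL _ _ _ _) _; first by lra.
  rewrite -[y](subrK x) addrC; apply: le_trans (ler_normD _ _) _.
  by rewrite lerD2l distrC ltW.
apply: (@le_trans _ _ (L * (e / (1 + L)))); first by rewrite ler_wpM2l // ltW.
by rewrite mulrA ler_pdivrMr ?ltr_wpDr //; lra.
Qed.

(** * The epigraphic constraint sets and the Slater bound *)

Lemma finite_uniform (R : realType) (T : eqType) (F : set T)
    (P : T -> R -> Prop) : finite_set F ->
  (forall y a b, a <= b -> P y a -> P y b) ->
  (forall y, F y -> exists a, P y a) -> exists a, forall y, F y -> P y a.
Proof.
move=> /finite_seqP[s ->] Pmono; elim: s => [|y s IH] Ps.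
  by exists 0 => y; rewrite /= in_nil.
have [a Pa] := Ps y (mem_head _ _).
have [|b Pb] := IH; first by move=> x xs; apply: Ps; rewrite /= inE xs orbT.
exists (Num.max a b) => x; rewrite /= inE => /predU1P[->|xs].
  by apply: Pmono Pa; rewrite le_max lexx.
by apply: Pmono (Pb _ xs); rewrite le_max lexx orbT.
Qed.

Lemma xpart_convex (R : realType) n m (a b : 'rV[R]_(n + m)) (l : R) :
  xpart (l *: a + (1 - l) *: b) = l *: xpart a + (1 - l) *: xpart b.
Proof. by apply/rowP => k; rewrite !mxE. Qed.

Lemma upart_convex (R : realType) n m (a b : 'rV[R]_(n + m)) (l : R) i :
  upart (l *: a + (1 - l) *: b) ord0 i =
  l * upart a ord0 i + (1 - l) * upart b ord0 i.
Proof. by rewrite !mxE. Qed.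

Lemma xpart_continuous (R : realType) n m :
  continuous (@xpart R n m).
Proof.
move=> x; apply/(@cvgrPdist_le _ _ _ (nbhs x) (nbhs_filter x)) => e e0.
apply/nbhs_ballP; exists e => //= y; rewrite -ball_normE /= => xy.
apply: le_trans (ltW xy); apply: norm_le_coord => // k.
by have := coord_le_norm (x - y) (lshift m k); rewrite !mxE.
Qed.

Lemma Omega_i_convex (R : realType) n m (X : set 'rV[R]_n)
    (f : 'I_m -> 'rV[R]_n -> R) (g : 'I_m -> 'rV[R]_n -> R -> R)
    (Yk : 'I_m -> set R) (eps : 'I_m -> R) (i : 'I_m) :
  convex_setv X -> convex_fun (f i) -> (forall y, Yk i y -> convex_fun (g i ^~ y)) ->
  convex_setv (Omega_i X f g Yk eps i).
Proof.
move=> Xc fc gc a b l [Xa [fa ga]] [Xb [fb gb]] l01.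
have [l0 l1] := andP l01; have l1' : 0 <= 1 - l by lra.
split; first by rewrite xpart_convex; exact: Xc.
rewrite xpart_convex upart_convex; split=> [|y Yy].
  have h1 := fc (xpart a) (xpart b) l l01.
  have h2 := ler_wpM2l l0 fa; have h3 := ler_wpM2l l1' fb.
  lra.
apply: le_trans (gc y Yy _ _ _ l01) _.
have h2 := ler_wpM2l l0 (ga y Yy); have h3 := ler_wpM2l l1' (gb y Yy); lra.
Qed.

Lemma Omega_i_closed (R : realType) n m (X : set 'rV[R]_n)
    (f : 'I_m -> 'rV[R]_n -> R) (g : 'I_m -> 'rV[R]_n -> R -> R)
    (Yk : 'I_m -> set R) (eps : 'I_m -> R) (i : 'I_m) :
  closed X -> continuous (f i) -> (forall y, Yk i y -> continuous (g i ^~ y)) ->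
  closed (Omega_i X f g Yk eps i).
Proof.
move=> Xcl fc gc.
have xc := @xpart_continuous R n m.
have c1 : closed ((@xpart R n m) @^-1` X) by exact: (continuous_closedP _).1.
have c2 : closed ((fun th : 'rV[R]_(n + m) => f i (xpart th) - upart th ord0 i)
    @^-1` [set r | r <= 0]).
  apply: (continuous_closedP _).1; last exact: closed_le.
  have -> : (fun th : 'rV[R]_(n + m) => f i (xpart th) - upart th ord0 i) =
      (f i \o @xpart R n m) - (fun th => th ord0 (rshift n i)).
    by apply/funext => th; rewrite /upart mxE.
  move=> th; apply: continuousB; last exact: coord_continuous.
  exact: continuous_comp (xc th) (fc _).
have c3 : closed (\bigcap_(y in Yk i)
    ((fun th : 'rV[R]_(n + m) => g i (xpart th) y) @^-1` [set r | r <= - eps i])).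
  apply: closed_bigI => y Yy.
  apply: (continuous_closedP _).1; last exact: closed_le.
  move=> th.
  exact: continuous_comp (xc th) (gc y Yy _).
exact: (closedI c1 (closedI c2 c3)).
Qed.

(** [Omega] is unbounded in [u], so compactness is applied in [x] only: a minimizer of the sum of
    the [f i] is lifted by taking u_i = f_i(x). *)
Lemma exists_Omega_star (R : realType) n m (X : set 'rV[R]_n)
    (f : 'I_m -> 'rV[R]_n -> R) (g : 'I_m -> 'rV[R]_n -> R -> R)
    (Yk : 'I_m -> set R) (eps : 'I_m -> R) :
  compact X -> (forall i, continuous (f i)) ->
  (forall i y, Yk i y -> continuous (g i ^~ y)) ->
  ADRCP_feasible X g Yk eps !=set0 ->
  exists z, Omega_star X f g Yk eps z.
Proof.
move=> Xco fc gc feas.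
have cl : closed (ADRCP_feasible X g Yk eps).
  have c1 : closed X by apply: compact_closed => //; exact: norm_hausdorff.
  have c2 : closed (\bigcap_(i in [set: 'I_m]) \bigcap_(y in Yk i)
    ((fun x => g i x y) @^-1` [set r | r <= - eps i])).
    apply: closed_bigI => i _; apply: closed_bigI => y Yy.
    by apply: (continuous_closedP _).1; [exact: gc|exact: closed_le].
  suff -> : ADRCP_feasible X g Yk eps = X `&` (\bigcap_(i in [set: 'I_m])
      \bigcap_(y in Yk i) ((fun x => g i x y) @^-1` [set r | r <= - eps i])).
    exact: closedI.
  apply/seteqP; split=> x [Xx gx]; split=> // i; first by move=> _ y; exact: gx.
  by move=> y; exact: gx.
have co : compact (ADRCP_feasible X g Yk eps).
  by apply: subclosed_compact cl Xco _ => x [].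
have Fc : continuous (fun x => \sum_i f i x).
  by apply: continuous_big => [|i _]; [exact: add_continuous|exact: fc].
have [x /set_mem[Xx gx] xmin] :=
  compact_EVT_min feas co (continuous_subspaceT Fc).
have f0E (th : 'rV[R]_(n + m)) : f0 th = m%:R^-1 * \sum_i upart th ord0 i.
  rewrite /f0 big_split_ord /= big1 ?add0r => [|k _].
    by rewrite mulr_sumr; apply: eq_bigr => k _; rewrite row_mxEr !mxE.
  by rewrite row_mxEl mxE mul0r.
pose z : 'rV[R]_(n + m) := row_mx x (\row_i f i x).
have xz : xpart z = x by exact: row_mxKl.
have uz i : upart z ord0 i = f i x by rewrite /upart row_mxKr mxE.
exists z; split=> [i|th Oth].
  by split; rewrite xz //; split=> [|y]; [rewrite uz subrr|exact: gx].
rewrite !f0E; apply: ler_wpM2l; first by rewrite invr_ge0.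
apply: (@le_trans _ _ (\sum_i f i (xpart th))).
  under eq_bigr do rewrite uz.
  (* Without agents both sums are empty; otherwise the constraint set of any agent puts [xpart th]
     in [X]. *)
  have [i|nom] := pselect (exists i : 'I_m, True); last first.
    by rewrite !big1 // => i _; case: nom; exists i.
  apply: xmin; apply/mem_set; split; first by case: i => i _; case: (Oth i).
  by move=> j y Yy; have [_ [_]] := Oth j; exact.
by apply: ler_sum => i _; have [_ [+ _]] := Oth i; rewrite subr_le0.
Qed.

(* Moving from w towards the Slater point far enough to restore feasibility
   costs a multiple of the constraint violation at w. *)
Lemma Slater_error_bound (R : realType) n m (X : set 'rV[R]_n)
    (f : 'I_m -> 'rV[R]_n -> R) (g : 'I_m -> 'rV[R]_n -> R -> R)
    (Yk : 'I_m -> set R) (eps : 'I_m -> R) (c z : 'rV[R]_(n + m))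
    (xt : 'rV[R]_n) (delta : R) :
  convex_setv X -> (forall i, convex_fun (f i)) ->
  (forall i y, Yk i y -> convex_fun (g i ^~ y)) ->
  Omega X f g Yk eps z ->
  (forall th, Omega X f g Yk eps th -> dotp c z <= dotp c th) ->
  X xt -> 0 < delta -> (forall i y, Yk i y -> g i xt y <= - eps i - delta) ->
  exists2 k : R, 0 <= k & forall (w : 'rV[R]_(n + m)) r, X (xpart w) -> 0 <= r ->
    (forall i, f i (xpart w) - upart w ord0 i <= r) ->
    (forall i y, Yk i y -> g i (xpart w) y <= - eps i + r) ->
    - (k * r) <= dotp c w - dotp c z.
Proof.
move=> Xc fc gc Oz zmin Xxt d0 gxt.
(* The Slater point is lifted with slack [delta] in the epigraph constraints as well. *)
pose s : 'rV[R]_(n + m) := row_mx xt (\row_i (f i xt + delta)).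
have xs : xpart s = xt by exact: row_mxKl.
have us i : upart s ord0 i = f i xt + delta by rewrite /upart row_mxKr mxE.
have Os : Omega X f g Yk eps s.
  move=> i; split; rewrite xs //; split=> [|y Yy]; first by rewrite us; lra.
  by have := gxt i y Yy; lra.
have zs := zmin _ Os.
exists ((dotp c s - dotp c z) / delta); first by rewrite divr_ge0 ?(ltW d0) // subr_ge0.
move=> w r Xw r0 fw gw.
have rd0 : 0 < r + delta by lra.
(* The weight with [l * delta = (1 - l) * r]: the slack at [s] exactly offsets the violation at
   [w]. *)
pose l := r / (r + delta).
have lE : l * (r + delta) = r by rewrite /l divfK // gt_eqF.
have l01 : 0 <= l <= 1.
  by rewrite /l divr_ge0 ?(ltW rd0) //= ler_pdivrMr // mul1r; lra.
have [l0 l1] := andP l01; have l1' : 0 <= 1 - l by lra.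
have : dotp c z <= dotp c (l *: s + (1 - l) *: w).
  apply: zmin => i; split; first by rewrite xpart_convex; apply: Xc => //; rewrite xs.
  rewrite xpart_convex upart_convex xs; split=> [|y Yy].
    have h1 := fc i xt (xpart w) l l01.
    have h2 := ler_wpM2l l1' (fw i).
    rewrite us; lra.
  apply: le_trans (gc i y Yy _ _ _ l01) _.
  have h1 := ler_wpM2l l0 (gxt i y Yy).
  have h2 := ler_wpM2l l1' (gw i y Yy); lra.
rewrite dotpDr !dotpZr -(ler_pM2r rd0) => h.
rewrite [_ / delta * r]mulrAC -mulNr ler_pdivrMr //.
have h1 : l * dotp c s * (r + delta) = r * dotp c s by rewrite mulrAC lE.
have h2 : (1 - l) * dotp c w * (r + delta) = delta * dotp c w.
  by rewrite mulrAC mulrBl lE mul1r addrC addKr.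
move: h; rewrite mulrDl h1 h2; lra.
Qed.

(** * Application to the iteration over the sets [Omega_i] *)

Unset Implicit Arguments.

Theorem theorem1 (R : realType) (n m : nat) (m_gt0 : (0 < m)%N)
  (E : nat -> rel 'I_m) (A : nat -> 'M[R]_m)
  (X : set 'rV[R]_n)
  (f : 'I_m -> 'rV[R]_n -> R)
  (Y : 'I_m -> set R) (g : 'I_m -> 'rV[R]_n -> R -> R)
  (Yk : 'I_m -> set R) (eps : 'I_m -> R)
  (alpha : nat -> R)
  (theta : 'I_m -> nat -> 'rV[R]_(n + m)) :
  UJSC E ->
  weight_rules E A ->
  X !=set0 -> compact X -> convex_setv X ->
  (forall i, convex_fun (f i)) ->
  (forall i, Y i !=set0 /\ compact (Y i) /\ convex_setR (Y i)) ->
  (forall i, {within X `*` Y i, continuous (fun p : 'rV[R]_n * R => g i p.1 p.2)}) ->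
  (forall i, convex_in_x (Y i) (g i)) ->
  (forall i, finite_set (Yk i) /\ Yk i `<=` Y i) ->
  (forall i, 0 < eps i) ->
  interior_point_condition X g Yk eps ->
  (forall t, 0 < alpha t) ->
  series alpha @ \oo --> +oo ->
  cvg (series (fun t => alpha t ^+ 2) @ \oo) ->
  (forall l t, (l < t)%N -> alpha t <= alpha l) ->
  (forall (i : 'I_m) t,
     is_proj (Omega_i X f g Yk eps i)
       (\sum_(j < m) A t i j *: theta j t - alpha t *: @cvec R n m)
       (theta i t.+1)) ->
  exists thstar, Omega_star X f g Yk eps thstar /\
    forall i, theta i t @[t --> \oo] --> thstar.
Proof.
move=> uj wr X0 Xco Xc fc _ _ gcY Ykf eps0 [feas [xt [[Xxt gxt] gxt']]] a0 aoo a2 _ pr.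
have gc i y : Yk i y -> convex_fun (g i ^~ y).
  by move=> Yy; apply: gcY; exact: (Ykf i).2.
have Xcl : closed X by apply: compact_closed => //; exact: norm_hausdorff.
have [z [Oz zmin]] := exists_Omega_star Xco (fun i => convex_fun_continuous (fc i))
  (fun i y Yy => convex_fun_continuous (gc i y Yy)) feas.
have [B B0 XB] : exists2 B : R, 0 < B & forall x, X x -> `|x| <= B.
  have [M0 [_ HM]] := compact_bounded Xco.
  exists (`|M0| + 1) => [|x Xx]; first by rewrite ltr_wpDl.
  by apply: HM => //; rewrite (le_lt_trans (ler_norm _)) // ltrDl.
have uniform (P : 'I_m -> R -> R -> Prop) :
    (forall i y a b, a <= b -> P i y a -> P i y b) ->
    (forall i y, Yk i y -> exists a, P i y a) ->
    exists a, forall i y, Yk i y -> P i y a.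
  move=> Pm Pe.
  have [|i a b ab H y Yy|i _|a aP] := @finite_uniform R 'I_m setT
      (fun i a => forall y, Yk i y -> P i y a).
  - exact: finite_finset.
  - exact: Pm ab (H y Yy).
  - apply: finite_uniform; [exact: (Ykf i).1|by move=> y a b; exact: Pm|exact: Pe].
  - by exists a => i; exact: aP.
(* The inverse of the slack is bounded, since [uniform] asks for a property that is upward closed in
   the parameter. *)
have [D gD] : exists D, forall i y, Yk i y -> 0 < D /\ D^-1 <= - eps i - g i xt y.
  apply: uniform => [i y a b ab [a1 ad]|i y Yy].
    have b1 := lt_le_trans a1 ab; split=> //.
    by apply: le_trans ad; rewrite lef_pV2 ?posrE.
  have d0 : 0 < - eps i - g i xt y by rewrite subr_gt0 gxt'.
  by exists (- eps i - g i xt y)^-1; rewrite invrK invr_gt0.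
(* If all [Yk i] are empty, [D] is arbitrary; the maximum with 1 keeps [delta] positive. *)
pose delta := (Num.max D 1)^-1.
have delta0 : 0 < delta by rewrite invr_gt0 lt_max ltr01 orbT.
have gdelta i y : Yk i y -> g i xt y <= - eps i - delta.
  move=> Yy; have [D0 Dd] := gD i y Yy.
  suff : delta <= D^-1 by lra.
  by rewrite lef_pV2 ?posrE ?lt_max ?D0 // le_max lexx.
have [k k0 slater] := Slater_error_bound Xc fc gc Oz zmin Xxt delta0 gdelta.
pose Lip (h : 'rV[R]_n -> R) L := 0 <= L /\
  forall x y, `|x| <= B -> `|y| <= B -> `|h x - h y| <= L * `|x - y|.
have LipS h a b : a <= b -> Lip h a -> Lip h b.
  move=> ab [ha H]; split=> [|x y xB yB]; first exact: le_trans ab.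
  by apply: le_trans (H x y xB yB) _; rewrite ler_wpM2r.
have LipE h : convex_fun h -> exists L, Lip h L.
  by move=> hc; have [L L0 HL] := convex_fun_lipschitz hc B0; exists L.
have [Lf fL] : exists L, forall i, [set: 'I_m] i -> Lip (f i) L.
  apply: finite_uniform => [|i a b|i _]; first exact: finite_finset.
    exact: LipS.
  exact: LipE.
have [Lg gL] : exists L, forall i y, Yk i y -> Lip (g i ^~ y) L.
  by apply: uniform => [i y a b|i y Yy]; [exact: LipS|exact: LipE (gc i y Yy)].
pose i0 := Ordinal m_gt0.
(* The maximum covers the change of [f i] and [g i] between two agents, the 1 the change of the [u]
   coordinate. *)
pose L := Num.max Lf Lg + 1.
have Lf0 : 0 <= Lf by case: (fL i0).
have L0 : 0 <= L by rewrite /L addr_ge0 // le_max Lf0.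
pose K := Omega_i X f g Yk eps.
(* The initial points are arbitrary and lie in their sets only after one projection, so network,
   stepsizes and iterates are all shifted by one slot. *)
pose th i t := theta i t.+1.
have Kth i t : K i (th i t) by exact: (pr i t).1.
have xd (a b : 'rV[R]_(n + m)) : `|xpart a - xpart b| <= `|a - b|.
  apply: norm_le_coord => // j.
  by have := coord_le_norm (a - b) (lshift m j); rewrite !mxE.
have ud (a b : 'rV[R]_(n + m)) i : upart b ord0 i - upart a ord0 i <= `|a - b|.
  apply: le_trans (ler_norm _) _; rewrite distrC.
  by have := coord_le_norm (a - b) (rshift n i); rewrite /upart !mxE.
(* Agent [i] satisfies its own constraints, so agent [i0] violates them by at most [L] times their
   distance, and [slater] applies. *)
have reg t : - (k * L * Num.sqrt (disagreement th t)) <=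
    dotp (cvec R n m) (th i0 t) - dotp (cvec R n m) z.
  set r := Num.sqrt _; have r0 : 0 <= r by exact: sqrtr_ge0.
  have near i : `|th i0 t - th i t| <= r.
    by apply: le_trans (norm_le_sqdist _ _) _; rewrite ler_wsqrtr // le_disagreement.
  have Lip_near h L' i : Lip h L' -> L' <= Num.max Lf Lg ->
      h (xpart (th i0 t)) - h (xpart (th i t)) <= Num.max Lf Lg * r.
    move=> [L'0 hL] L'm; apply: le_trans (ler_norm _) _.
    apply: le_trans (hL _ _ (XB _ (Kth i0 t).1) (XB _ (Kth i t).1)) _.
    by apply: ler_pM => //; exact: le_trans (xd _ _) (near i).
  rewrite -mulrA; apply: slater => [|||].
  - exact: (Kth i0 t).1.
  - exact: mulr_ge0.
  - move=> i; have [_ [fi _]] := Kth i t.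
    have := Lip_near (f i) Lf i (fL i I); rewrite le_max lexx => /(_ isT).
    have := ud (th i0 t) (th i t) i; have := near i.
    by rewrite /L; lra.
  - move=> i y Yy; have [_ [_ gi]] := Kth i t.
    have := Lip_near (g i ^~ y) Lg i (gL i y Yy); rewrite le_max lexx orbT => /(_ isT).
    by have := gi y Yy; rewrite /L; lra.
have uj' : UJSC (fun t => E t.+1).
  by have [S [S0 conn]] := uj; exists S; split=> // t; exact: (conn t.+1).
have wr' : weight_rules (fun t => E t.+1) (fun t => A t.+1).
  have [w1 [w2 [w3 [gam [gam0 w4]]]]] := wr.
  split; [by move=> t; exact: w1|split; [by move=> t; exact: w2|split]].
    by move=> t; exact: w3.
  by exists gam; split=> // t; exact: w4.
have sumS (u : nat -> R) T :
    \sum_(0 <= t < T.+1) u t = u 0%N + \sum_(0 <= t < T) u t.+1.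
  by rewrite big_nat_recl.
have a2' : exists B, forall T, \sum_(0 <= t < T) alpha t.+1 ^+ 2 <= B.
  exists (limn (series (fun t => alpha t ^+ 2))) => T.
  apply: (@le_trans _ _ (series (fun t => alpha t ^+ 2) T.+1)).
    by rewrite /series /= (sumS (fun t => alpha t ^+ 2)) lerDr sqr_ge0.
  apply: nondecreasing_cvgn_le => //; apply: nondecreasing_series => t _ _.
  exact: sqr_ge0.
have aoo' C : exists T, C < \sum_(0 <= t < T) alpha t.+1.
  have [N _ HN] := (cvgryPge _).1 aoo (C + alpha 0%N + 1).
  exists N; have := HN N.+1 (leqnSn N); rewrite /series /= sumS; lra.
have Kc i : convex_setv (K i) by apply: Omega_i_convex => // y; exact: gc.
have Kcl i : closed (K i).
  apply: Omega_i_closed => //; first exact: convex_fun_continuous.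
  by move=> y Yy; apply: convex_fun_continuous; exact: gc.
have [ths [Kths cths lim]] := distributed_projection_cvg uj' wr' Kc Kcl
  (fun t => a0 t.+1) a2' aoo' Kth (fun i t => pr i t.+1) Oz
  (mulr_ge0 k0 L0) reg.
exists ths; split; first by split=> // y Oy; exact: le_trans cths (zmin y Oy).
move=> i; rewrite -(cvg_shiftS (theta i)); exact: lim.
Qed.
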